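(* Let $\mathcal{F}$ be a class of piecewise continuous functions with compact support contained in $[0,\infty)$ such that for every pair $f_1,f_2\in\mathcal{F}$ there are finitely many intervals covering $\operatorname{supp}f_1\cup\operatorname{supp}f_2$ such that on each of these intervals one of the two functions is larger than or equal to the other. Then $\preceq$ is total when restricted to the compactly supported absolutely continuous probability measures with densities in $\mathcal{F}$; that is, for any two such measures $\mu_1,\mu_2$ we have $\mu_1\preceq\mu_2$ or $\mu_2\preceq\mu_1$.
   Context: $\mathbb{N}$ is the set of natural numbers including $0$. For a finite positive Borel measure $\mu$ on $[0,\infty)$ all of whose moments $s_n(\mu)=\int_0^\infty t^n\,d\mu(t)$, $n\in\mathbb{N}$, exist, the tail relation is defined by: $\mu_1\preceq\mu_2$ if and only if there is $n_0\in\mathbb{N}$ such that $s_n(\mu_1)\le s_n(\mu_2)$ for all $n\ge n_0$. Densities are with respect to Lebesgue measure. *)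

(* Defs.v *)
From HB Require Import structures.
From mathcomp Require Import all_boot all_order all_algebra.
From mathcomp Require Import all_classical all_reals all_analysis.
Set Implicit Arguments.
Unset Strict Implicit.
Unset Printing Implicit Defensive.
Import Order.TTheory GRing.Theory Num.Theory.
Import numFieldNormedType.Exports.
Local Open Scope classical_set_scope.
Local Open Scope ring_scope.

(* Functions on [0, +oo[ are represented by their extension by 0 to R. *)
Definition fun_supp (R : realType) (f : R -> R) : set R :=
  closure [set x | f x != 0].

(* Since the functions considered have compact support, finitely many
   break points on the whole line is the same as finitely many on each bounded
   interval. One-sided limits are finite; the value at a break point is
   arbitrary. *)
Definition piecewise_continuous (R : realType) (f : R -> R) : Prop :=
  exists s : seq R,
    (forall x, x \notin s -> {for x, continuous f}) /\
    (forall x, x \in s ->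
      (exists l : R, f y @[y --> x^'-] --> l) /\
      (exists l : R, f y @[y --> x^'+] --> l)).

Definition finitely_piecewise_comparable (R : realType) (f g : R -> R) : Prop :=
  exists s : seq (interval R),
    (forall x, (fun_supp f `|` fun_supp g) x -> exists2 I, I \in s & x \in I) /\
    (forall I, I \in s ->
      (forall x, x \in I -> f x <= g x) \/ (forall x, x \in I -> g x <= f x)).

Section Measures.
Variable R : realType.
Implicit Types mu : {finite_measure set (measurableTypeR R) -> \bar R}.

Definition meas_supp mu : set R :=
  [set x | forall U : set R, open U -> U x -> (0 < mu U)%E].

Definition has_density mu (f : R -> R) : Prop :=
  forall A : set (measurableTypeR R), measurable A ->
    mu A = (\int[lebesgue_measure]_(x in A) (f x)%:E)%E.

(* Borel measures on [0, +oo[ are the Borel measures on R giving no mass to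
   ]-oo, 0[. *)
Definition tail_domain mu : Prop :=
  mu `]-oo, 0[%classic = 0%E /\
  forall n : nat, mu.-integrable `[0, +oo[ (fun t : R => (t ^+ n)%:E).

Definition moment mu (n : nat) : R := \int[mu]_(t in `[0, +oo[) (t ^+ n).

Definition tail_le mu1 mu2 : Prop :=
  [/\ tail_domain mu1, tail_domain mu2 &
      exists n0 : nat, forall n : nat, (n0 <= n)%N ->
        moment mu1 n <= moment mu2 n].

End Measures.

Definition measures_with_density_in (R : realType) (F : set (R -> R)) :
    set (probability (measurableTypeR R) R) :=
  [set mu | [/\ compact (meas_supp mu),
                mu `<< (@lebesgue_measure R) &
                exists2 f, F f & has_density mu f]].

(* Main.v *)
Require Import Defs.
From mathcomp Require Import all_boot all_order all_algebra.
From mathcomp Require Import all_classical all_reals all_analysis.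
From mathcomp Require Import measurable_realfun.
From mathcomp Require Import lra.
Import Order.TTheory GRing.Theory Num.Theory.
Import numFieldNormedType.Exports.
Local Open Scope classical_set_scope.
Local Open Scope ring_scope.

(** The densities are compared through the measures they define, never through
the moment integrals of [t ^+ n * f t].

Let mu and nu be the two measures, with densities f and g, and let M be the
least c >= 0 such that mu and nu coincide on the Borel subsets of the half-line
t >= c; M exists because both densities vanish far out and because points are
null ([agree_beyond_inf]).  If M = 0, all moments are equal.  Otherwise M is
the place where the measures separate when coming from +oo.  Finitely many
intervals cannot oscillate at M: each of them either contains a left
neighbourhood of M or misses one, so one density, say f, is at most the other
on some open interval from c to M ([comparable_at_left]).  Hence mu <= nu on
the Borel subsets of the half-line t > c.  Minimality of M makes this strict
somewhere beyond any a with c < a < M, and therefore on the whole half-line: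
mu{t >= a} < nu{t >= a} ([tail_le_of_le_at_left]).

It remains to see that such a dominance orders the moments
([tail_le_of_tail_dominance]).  The part of the n-th moment beyond c is larger
for nu than for mu by at least a ^ n times the positive difference of the
masses of {t >= a}, whereas the part on {0 <= t <= c} contributes at most
c ^ n times the total mass of mu; since c < a, the former wins for large n. *)

(** * Monotonicity of the integral in the function and in the measure *)

(** Both parts of an integral are suprema over the simple functions lying
below, so monotonicity is an inclusion of sets of minorants, valid for
arbitrary functions. *)
Lemma le_integral_pointwise (d : measure_display) (T : measurableType d)
    (R : realType) (mu : {measure set T -> \bar R}) (D : set T)
    (f g : T -> \bar R) :
  (forall x, D x -> f x <= g x)%E ->
  (\int[mu]_(x in D) f x <= \int[mu]_(x in D) g x)%E.
Proof.
move=> fg.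
have fgD x : (f \_ D x <= g \_ D x)%E.
  by rewrite /patch; case: ifPn => // /[!inE]; exact: fg.
rewrite /integral leeB//; apply: ereal_sup_le => _ [h hle <-]; exists h => // x.
  apply: (le_trans (hle x)).
  by apply: (@funepos_le _ _ setT); rewrite ?inE// => y _; exact: fgD.
apply: (le_trans (hle x)).
by apply: (@funeneg_le _ _ setT); rewrite ?inE// => y _; exact: fgD.
Qed.

(** Only the traces of the measures on S matter: after restricting both to S,
the comparison holds on all measurable sets. *)
Lemma le_measure_integral_in (d : measure_display) (T : measurableType d)
    (R : realType) (m1 m2 : {measure set T -> \bar R}) (S : set T)
    (f : T -> \bar R) :
  measurable S -> (forall A, measurable A -> A `<=` S -> m1 A <= m2 A)%E ->
  (forall x, S x -> 0 <= f x)%E -> measurable_fun S f ->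
  (\int[m1]_(x in S) f x <= \int[m2]_(x in S) f x)%E.
Proof.
move=> mS m12 f0 mf.
have restrE (m : {measure set T -> \bar R}) :
    (\int[m]_(x in S) f x = \int[mrestr m mS]_x (f \_ S) x)%E.
  rewrite (@eq_measure_integral _ _ _ S (mrestr m mS)).
    by rewrite integral_mkcond.
  by move=> A _ AS /=; rewrite /mrestr (setIidl AS).
rewrite !restrE; apply: ge0_le_measure_integral => //.
- move=> A mA /=; rewrite /mrestr; apply: m12; first exact: measurableI.
  exact: subIsetr.
- exact: erestrict_ge0.
- by apply/(measurable_restrictT f mS).
Qed.

(** * Dominance on a half-line orders the moments *)

Section TailDominance.
Variable R : realType.
Implicit Types mu nu : {finite_measure set (measurableTypeR R) -> \bar R}.

Lemma moment_fin_num mu n : tail_domain mu ->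
  (\int[mu]_(t in `[0%R, +oo[) (t ^+ n)%:E)%E \is a fin_num.
Proof. by move=> [_ h]; apply: integrable_fin_num => //; exact: h. Qed.

Lemma eventually_geometric_domination (c a K e : R) :
  0 <= c -> c < a -> 0 < e ->
  exists n0 : nat, forall n, (n0 <= n)%N -> c ^+ n * K <= a ^+ n * e.
Proof.
move=> c0 ca e0; have a0 : 0 < a by exact: le_lt_trans ca.
have h : `|c / a| < 1.
  by rewrite ger0_norm ?divr_ge0 ?(ltW a0)// ltr_pdivrMr// mul1r.
have {}h : (c / a) ^+ n * K @[n --> \oo] --> 0 * K.
  by apply: cvgMl; exact: cvg_expr.
rewrite mul0r in h.
have [n0 _ hn] : \forall n \near \oo, (c / a) ^+ n * K < e.
  by apply: (cvgr_lt _ h).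
exists n0 => n /hn/= /ltW; rewrite expr_div_n mulrAC ler_pdivrMr ?exprn_gt0//.
by rewrite [e * _]mulrC.
Qed.

Lemma measurable_monomial (D : set (measurableTypeR R)) (n : nat) :
  measurable_fun D (fun t : R => (t ^+ n)%:E).
Proof.
apply/measurable_EFinP.
exact: exprn_measurable.
Qed.

(** What is left of the n-th power after its minimum a ^ n on {t >= a} has been
subtracted there; it stays nonnegative, hence still monotone in the measure. *)
Definition excess (c a : R) (n : nat) (t : R) : R :=
  t ^+ n - a ^+ n * \1_`[a, +oo[ t.

Lemma excess_ge0 (c a : R) (n : nat) (t : R) :
  0 <= c -> c < a -> t \in `]c, +oo[ -> 0 <= excess c a n t.
Proof.
move=> c0 ca; rewrite in_itv/= andbT => ct; rewrite /excess indicE.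
have a0 : 0 <= a by apply: ltW; exact: le_lt_trans ca.
have [|_] := boolP (t \in _) => /=; last first.
  by rewrite mulr0 subr0 exprn_ge0// ltW// (le_lt_trans c0).
rewrite inE/= in_itv/= andbT => at_; rewrite mulr1 subr_ge0 lerXn2r//.
by rewrite nnegrE (le_trans a0).
Qed.

Lemma measurable_excess (c a : R) (n : nat) (D : set (measurableTypeR R)) :
  measurable_fun D (fun t => (excess c a n t)%:E).
Proof.
apply/measurable_EFinP; apply: measurable_funB.
  exact: exprn_measurable.
apply: measurable_funM => //.
Qed.

(** Isolates the mass of {t >= a}, on which the strict inequality between the
two measures is known. *)
Lemma integral_peel_tail mu (c a : R) (n : nat) : 0 <= c -> c < a ->
  (\int[mu]_(t in `]c, +oo[) (t ^+ n)%:E =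
   \int[mu]_(t in `]c, +oo[) (excess c a n t)%:E
   + (a ^+ n)%:E * mu `[a, +oo[%classic)%E.
Proof.
move=> c0 ca.
have mE : measurable (`[a, +oo[%classic : set (measurableTypeR R)).
  exact: measurable_itv.
have a0 : 0 <= a by apply: ltW; exact: le_lt_trans ca.
have mI D : measurable_fun D
    (fun t : measurableTypeR R => (\1_`[a, +oo[ t : R)%:E).
  by apply/measurable_EFinP; exact: measurable_indic.
have -> : ((a ^+ n)%:E * mu `[a, +oo[%classic =
    \int[mu]_(t in `]c, +oo[) ((a ^+ n)%:E * (\1_`[a, +oo[ t)%:E))%E.
  rewrite ge0_integralZl//=; last by rewrite lee_fin exprn_ge0.
  rewrite integral_indic//; congr (_ * mu _)%E; apply/esym/setIidl.
  by move=> x /=; rewrite !in_itv/= !andbT; exact: lt_le_trans.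
rewrite -ge0_integralD//=.
- by apply: eq_integral => t _; rewrite -EFinM -EFinD subrK.
- by move=> t ct; rewrite lee_fin; exact: excess_ge0.
- exact: measurable_excess.
- by move=> t _; rewrite -EFinM lee_fin mulr_ge0 ?exprn_ge0.
- apply: emeasurable_funM => //.
Qed.

(** With D the difference of the masses of {t >= a} and K the total mass of mu,
the n-th moment of nu is at least that of mu plus a ^ n * D - c ^ n * K. *)
Lemma tail_le_of_tail_dominance mu nu (c a : R) :
  tail_domain mu -> tail_domain nu -> 0 <= c -> c < a ->
  (forall A : set (measurableTypeR R), measurable A -> A `<=` `]c, +oo[ ->
     mu A <= nu A)%E ->
  (mu `[a, +oo[%classic < nu `[a, +oo[%classic)%E ->
  tail_le mu nu.
Proof.
move=> dmu dnu c0 ca le_mu_nu lt_mu_nu; split=> //.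
set E := `[a, +oo[%classic : set (measurableTypeR R).
have mE : measurable E by exact: measurable_itv.
have fmu B : measurable B -> mu B \is a fin_num by exact: fin_num_measure.
have fnu : nu E \is a fin_num by exact: fin_num_measure.
have e0 : 0 < fine (nu E) - fine (mu E).
  by rewrite subr_gt0 -lte_fin !fineK// fmu.
have [n0 hn] :=
  @eventually_geometric_domination c a (fine (mu setT)) _ c0 ca e0.
exists n0 => n /hn {}hn.
rewrite /moment /Rintegral fine_le ?moment_fin_num//.
have splitI (m : {finite_measure set (measurableTypeR R) -> \bar R}) :
    (\int[m]_(t in `[0%R, +oo[) (t ^+ n)%:E =
     \int[m]_(t in `[0%R, c]) (t ^+ n)%:E
     + \int[m]_(t in `]c, +oo[) (t ^+ n)%:E)%E.
  rewrite -ge0_integral_setU//=.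
  - congr integral; apply/seteqP; split=> x /=; rewrite !in_itv/= !andbT.
      by move=> ->/=; case: leP => ?; [left|right].
    by case=> [/andP[]//|/ltW]; exact: le_trans.
  - exact: measurable_monomial.
  - move=> t; rewrite /= !in_itv/= andbT lee_fin => h; apply: exprn_ge0.
    by case: h => [/andP[]//|/ltW]; exact: le_trans.
  - apply/disj_set2P/seteqP; split=> x //=; rewrite !in_itv/= andbT.
    by move=> [/andP[_ xc] /(le_lt_trans xc)]; rewrite ltxx.
rewrite !splitI.
have low : (\int[mu]_(t in `[0%R, c]) (t ^+ n)%:E <=
    (c ^+ n * fine (mu setT))%:E)%E.
  apply: (@le_trans _ _ (\int[mu]_(t in `[0%R, c]) cst (c ^+ n)%:E t)%E).
    apply: le_integral_pointwise => t /=; rewrite in_itv/= => /andP[t0 tc].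
    by rewrite lee_fin lerXn2r.
  rewrite integral_cst//= EFinM fineK ?fmu//.
  by rewrite lee_wpmul2l ?lee_fin ?exprn_ge0// le_measure ?inE.
have low0 : (0 <= \int[nu]_(t in `[0%R, c]) (t ^+ n)%:E)%E.
  by apply: integral_ge0 => t /=; rewrite in_itv/= lee_fin => /andP[t0 _];
    exact: exprn_ge0.
rewrite !(@integral_peel_tail _ c a n)//.
have high : (\int[mu]_(t in `]c, +oo[) (excess c a n t)%:E <=
   \int[nu]_(t in `]c, +oo[) (excess c a n t)%:E)%E.
  apply: le_measure_integral_in => //.
  - by move=> t ct; rewrite lee_fin; exact: excess_ge0.
  - exact: measurable_excess.
apply: (le_trans (leeD low (leeD high (lexx _)))).
apply: (@le_trans _ _ (0 + (\int[nu]_(t in `]c, +oo[) (excess c a n t)%:E +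
  ((a ^+ n)%:E * nu E)))%E); last exact: leeD.
rewrite add0e addeCA leeD2l// -(fineK fnu) -[X in (_ + _ * X)%E]fineK ?fmu//.
by rewrite -!EFinM -EFinD lee_fin; lra.
Qed.

End TailDominance.


(** * Finitely many intervals near a point *)

Section Comparison.
Variable R : realType.
Implicit Types mu nu : {finite_measure set (measurableTypeR R) -> \bar R}.

Lemma at_left_interval (I : interval R) (M : R) :
  (\forall x \near M^'-, x \in I) \/ (\forall x \near M^'-, x \notin I).
Proof.
case: I => l r.
have [Hl|Hl] : (\forall x \near M^'-, (l <= BLeft x)%O) \/
    (\forall x \near M^'-, ~~ (l <= BLeft x)%O).
- case: l => [b y|[]]; last 2 first.
  + by left; near=> x.
  + by right; near=> x.
  have [yM|My] := ltP y M; [left|right]; near=> x.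
    have yx : y < x by near: x; exact: nbhs_left_gt.
    by case: b; rewrite bnd_simp// ltW.
  have xM : x < M by near: x; exact: nbhs_left_lt.
  by case: b; rewrite bnd_simp -?ltNge -?leNgt ?(lt_le_trans xM)// ltW//
    (lt_le_trans xM).
- have [Hr|Hr] : (\forall x \near M^'-, (BRight x <= r)%O) \/
      (\forall x \near M^'-, ~~ (BRight x <= r)%O).
  + case: r => [b y|[]]; last 2 first.
    * by right; near=> x.
    * by left; near=> x.
    have [yM|My] := ltP y M; [right|left]; near=> x.
      have yx : y < x by near: x; exact: nbhs_left_gt.
      by case: b; rewrite bnd_simp -?ltNge -?leNgt// ltW.
    have xM : x < M by near: x; exact: nbhs_left_lt.
    by case: b; rewrite bnd_simp ?(lt_le_trans xM)// ltW// (lt_le_trans xM).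
  + by left; near=> x; rewrite itv_boundlr; apply/andP; split; near: x.
  + right; near=> x; rewrite itv_boundlr negb_and; apply/orP; right.
    by near: x.
- right; near=> x; rewrite itv_boundlr negb_and; apply/orP; left.
  by near: x.
Unshelve. all: by end_near. Qed.

Lemma at_left_intervals (s : seq (interval R)) (M : R) :
  (exists2 I, I \in s & \forall x \near M^'-, x \in I) \/
  (\forall x \near M^'-, forall I, I \in s -> x \notin I).
Proof.
elim: s => [|J s [[I Is HI]|Hs]]; first by right; near=> x.
  by left; exists I => //; rewrite in_cons Is orbT.
have [HJ|HJ] := at_left_interval J M.
  by left; exists J; rewrite ?mem_head.
right; near=> x => I; rewrite in_cons => /predU1P[->|]; first by near: x.
by move: I; near: x.
Unshelve. all: by end_near. Qed.

Lemma neq0_fun_supp (f : R -> R) (x : R) : f x != 0 -> fun_supp f x.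
Proof. exact: (@subset_closure _ [set x | f x != 0]). Qed.

(** If no interval of the cover contains a left neighbourhood of M, then some
left neighbourhood avoids them all, so that both functions vanish on it. *)
Lemma comparable_at_left (f g : R -> R) (M : R) :
  finitely_piecewise_comparable f g ->
  (\forall x \near M^'-, f x <= g x) \/ (\forall x \near M^'-, g x <= f x).
Proof.
move=> [s [cover cmp]].
have [[I Is HI]|Hs] := at_left_intervals s M.
  by have [le|le] := cmp I Is; [left|right]; near=> x; apply: le; near: x.
left; near=> x.
have xs : forall I, I \in s -> x \notin I by near: x.
have off : ~ (fun_supp f `|` fun_supp g) x.
  by move=> /cover[I /xs/negP].
have fx : f x = 0.
  by apply/eqP/negPn/negP => fx; apply: off; left; exact: neq0_fun_supp.
have gx : g x = 0.
  by apply/eqP/negPn/negP => gx; apply: off; right; exact: neq0_fun_supp.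
by rewrite fx gx.
Unshelve. all: by end_near. Qed.

(** * Measures given by a density *)

Lemma density_le mu nu (f g : R -> R) (A : set (measurableTypeR R)) :
  has_density mu f -> has_density nu g -> measurable A ->
  (forall x, A x -> f x <= g x) -> (mu A <= nu A)%E.
Proof.
move=> df dg mA fg; rewrite df// dg//.
by apply: le_integral_pointwise => x Ax; rewrite lee_fin fg.
Qed.

Lemma density_null mu (f : R -> R) (A : set (measurableTypeR R)) :
  has_density mu f -> measurable A -> (forall x, A x -> f x = 0) ->
  mu A = 0%E.
Proof.
by move=> df mA f0; rewrite df//; apply: integral0_eq => x /f0 ->.
Qed.

Lemma compact_supp_bounded (f : R -> R) : compact (fun_supp f) ->
  exists K : R, forall x, K <= x -> f x = 0.
Proof.
move=> /compact_bounded[K0 [_ hK]]; exists (K0 + 2) => x Kx.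
apply/eqP/negPn/negP => fx.
have /= := hK (K0 + 1) _ x (neq0_fun_supp _ _ fx).
rewrite ltrDl ltr01 => /(_ isT) /(le_trans (ler_norm _)) xK.
by move: Kx; lra.
Qed.

Lemma density_tail_domain mu (f : R -> R) : has_density mu f ->
  compact (fun_supp f) -> fun_supp f `<=` `[0, +oo[ -> tail_domain mu.
Proof.
move=> df cf f_pos; split.
  apply: (density_null _ _ _ df) => //= x; rewrite in_itv/= => x0.
  apply/eqP/negPn/negP => fx; have /f_pos := neq0_fun_supp _ _ fx.
  by rewrite /= in_itv/= andbT leNgt x0.
move=> n; have [K fK] := compact_supp_bounded _ cf.
apply/(@negligible_integrable _ _ _ mu _ `[K, +oo[%classic) => //.
- exact: measurable_monomial.
- by apply: (density_null _ _ _ df) => //= x; rewrite in_itv/= andbT; exact: fK.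
apply: (@integrableS _ _ _ mu `[0, K]%classic) => //.
- exact: measurableD.
- move=> x /= []; rewrite !in_itv/= !andbT => -> /negP.
  by rewrite -ltNge; exact: ltW.
apply: measurable_bounded_integrable => //.
- by rewrite -ge0_fin_numE// fin_num_measure.
- exists (K ^+ n); split => [|r Kr x /=]; first exact: num_real.
  rewrite in_itv/= => /andP[x0 xK]; rewrite (le_trans _ (ltW Kr))//.
  by rewrite ger0_norm ?exprn_ge0// lerXn2r// nnegrE (le_trans x0).
Qed.

(** * The last point where the measures separate *)

Definition agree_beyond mu nu (c : R) : Prop :=
  forall A : set (measurableTypeR R), measurable A -> A `<=` `[c, +oo[ ->
    mu A = nu A.

Lemma tail_le_of_agree mu nu : tail_domain mu -> tail_domain nu ->
  agree_beyond mu nu 0 -> tail_le mu nu.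
Proof.
move=> dmu dnu E; split=> //; exists 0 => n _.
rewrite /moment /Rintegral (@eq_measure_integral _ _ _ _ nu)//.
Qed.

(** A Borel set beyond inf S is, up to the null point inf S, the increasing
union of its traces on t >= inf S + 1 / (n + 1), each of which lies beyond an
element of S; continuity from below gives the equality in the limit. *)
Lemma agree_beyond_inf mu nu (S : set R) :
  S !=set0 -> has_lbound S -> (forall c, S c -> agree_beyond mu nu c) ->
  mu [set inf S] = 0%E -> nu [set inf S] = 0%E ->
  agree_beyond mu nu (inf S).
Proof.
move=> S0 Slb HS mu0 nu0 A mA AM.
set M := inf S.
pose B (n : nat) := A `&` `[M + n.+1%:R^-1, +oo[%classic.
have mB n : measurable (B n : set (measurableTypeR R)).
  by apply: measurableI => //; exact: measurable_itv.
have mUB : measurable (\bigcup_n B n : set (measurableTypeR R)).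
  exact: bigcup_measurable.
have m1 : measurable ([set M] : set (measurableTypeR R)).
  exact: measurable_set1.
have ndB : {homo B : n m / (n <= m)%N >-> (n <= m)%O}.
  move=> n m nm; apply/subsetPset; apply: setIS => x /=.
  rewrite !in_itv/= !andbT; apply: le_trans; rewrite lerD2l lef_pV2 ?posrE//.
  by rewrite ler_nat.
have UB (m : {finite_measure set (measurableTypeR R) -> \bar R}) :
    m [set M] = 0%E -> m A = m (\bigcup_n B n).
  move=> mM; apply/eqP; rewrite eq_le; apply/andP; split.
    have AU : A `<=` \bigcup_n B n `|` [set M].
      move=> x Ax; have := AM x Ax; rewrite /= in_itv/= andbT le_eqVlt.
      move=> /predU1P[<-|Mx]; first by right.
      left; have [n Mnx] := ltr_add_invr Mx.
      by exists n => //; split => //=; rewrite in_itv/= andbT ltW.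
    apply: (le_trans (le_measure m _ _ AU)); rewrite ?inE//.
      exact: measurableU.
    apply: (le_trans (measureU2 m mUB m1)).
    by rewrite [X in (_ + X)%E](mM : m [set M] = 0%E) adde0.
  by apply: le_measure; rewrite ?inE// => x [n _ []].
rewrite !UB//.
have cmu := @nondecreasing_cvg_mu _ _ _ mu B mB mUB ndB.
have cnu := @nondecreasing_cvg_mu _ _ _ nu B mB mUB ndB.
have munuB : mu \o B = nu \o B.
  apply/funext => n /=.
  have n_gt0 : 0 < n.+1%:R^-1 :> R by rewrite invr_gt0.
  have [e Se eM] := inf_adherent n_gt0 (conj S0 Slb).
  apply: (HS e Se) => // x [_]; rewrite /= !in_itv/= !andbT; apply: le_trans.
  exact: ltW.
rewrite munuB in cmu.
exact: cvg_unique cmu cnu.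
Qed.


Lemma at_left_ex_itv (M : R) (P : R -> Prop) : (\forall x \near M^'-, P x) ->
  exists2 c, c < M & forall x, x \in `]c, M[ -> P x.
Proof.
move=> /nbhs_ballP[e /= e0 He]; exists (M - e); first by rewrite ltrBlDr ltrDl.
move=> x; rewrite in_itv/= => /andP[ex xM]; apply: He => //.
by rewrite /ball/= ger0_norm ?subr_ge0 1?ltW// ltrBlDr addrC -ltrBlDr.
Qed.

(** The separation point M is positive, so the dominance at its left can be
started from some c >= 0.  Disagreement beyond a is a strict inequality on some
Borel set A; the rest of the half-line cannot compensate for it, so the whole
half-line has strictly larger mass under nu. *)
Lemma tail_le_of_le_at_left mu nu (f g : R -> R) (M : R) :
  has_density mu f -> has_density nu g -> tail_domain mu -> tail_domain nu ->
  0 < M -> (\forall x \near M^'-, f x <= g x) ->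
  agree_beyond mu nu M ->
  (forall b, 0 <= b -> b < M -> ~ agree_beyond mu nu b) ->
  tail_le mu nu.
Proof.
move=> df dg tmu tnu M0 /at_left_ex_itv[c0 c0M le_fg] agreeM disagree.
(* Any a strictly between c and M works: a > c for the growth of the powers,
   a < M for the disagreement beyond a. *)
pose c := Num.max c0 0; pose a := (c + M) / 2.
have cM : c < M by rewrite /c gt_max c0M.
have c_ge0 : 0 <= c by rewrite /c le_max lexx orbT.
have ca : c < a by rewrite /a; lra.
have aM : a < M by rewrite /a; lra.
have le_beyond A : measurable (A : set (measurableTypeR R)) ->
    A `<=` `]c, +oo[ -> (mu A <= nu A)%E.
  move=> mA Ac.
  have m1 : measurable (A `&` `]c, M[ : set (measurableTypeR R)).
    by apply: measurableI => //; exact: measurable_itv.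
  have m2 : measurable (A `&` `[M, +oo[ : set (measurableTypeR R)).
    by apply: measurableI => //; exact: measurable_itv.
  have -> : A = (A `&` `]c, M[) `|` (A `&` `[M, +oo[).
    rewrite -setIUr; apply/esym/setIidl => x /Ac /=; rewrite !in_itv/= !andbT.
    by move=> ->/=; case: (ltP x M) => ?; [left|right].
  have dis : (A `&` `]c, M[) `&` (A `&` `[M, +oo[) = set0.
    apply/seteqP; split=> x //= [[_]] + [_]; rewrite !in_itv/= andbT.
    by move=> /andP[_ xM] /(lt_le_trans xM); rewrite ltxx.
  rewrite !measureU//; apply: leeD; last first.
    have agree_le : (mu (A `&` `[M, +oo[) <= nu (A `&` `[M, +oo[))%E.
      by rewrite agreeM//; exact: subIsetr.
    exact: agree_le.
  apply: (density_le _ _ _ _ _ df dg) => // x [_] /=; rewrite in_itv/= => xcM.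
  apply: le_fg; rewrite in_itv/=; case/andP: xcM => cx ->; rewrite andbT.
  by move: cx; rewrite /c gt_max => /andP[].
apply: (@tail_le_of_tail_dominance _ _ _ c a) => //.
(* If nu gave no more mass to {t >= a}, then le_beyond would force agreement
   beyond a. *)
rewrite ltNge; apply/negP => ge_E.
have a0 : 0 <= a by rewrite (le_trans c_ge0)// ltW.
apply: (disagree a a0 aM) => A mA Aa.
have mE : measurable (`[a, +oo[%classic : set (measurableTypeR R)).
  exact: measurable_itv.
have Ec : `[a, +oo[ `<=` `]c, +oo[.
  by move=> x /=; rewrite !in_itv/= !andbT; exact: lt_le_trans.
have mD : measurable (`[a, +oo[ `\` A : set (measurableTypeR R)).
  exact: measurableD.
have le1 : (mu A <= nu A)%E by apply: le_beyond => // x /Aa; exact: Ec.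
have le2 : (mu (`[a, +oo[ `\` A) <= nu (`[a, +oo[ `\` A))%E.
  by apply: le_beyond => // x [] /Ec.
have splitE (m : {finite_measure set (measurableTypeR R) -> \bar R}) :
    (m `[a, +oo[%classic = m A + m (`[a, +oo[ `\` A))%E.
  have EA : (`[a, +oo[%classic : set R) = A `|` (`[a, +oo[ `\` A).
    by rewrite setDE setUIr setUCr setIT; apply/esym/setUidr.
  by rewrite [in LHS]EA measureU ?setDIK.
move: ge_E; rewrite !splitE => ge_E.
apply/eqP; rewrite eq_le le1/=.
have fin (m : {finite_measure set (measurableTypeR R) -> \bar R}) B :
  measurable B -> m B \is a fin_num by exact: fin_num_measure.
rewrite -(leeD2rE _ _ (fin nu _ mD)).
by apply: (le_trans ge_E); exact: leeD.
Qed.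

Lemma tail_le_total_of_comparable mu nu (f g : R -> R) :
  has_density mu f -> has_density nu g ->
  mu `<< (@lebesgue_measure R) -> nu `<< (@lebesgue_measure R) ->
  compact (fun_supp f) -> compact (fun_supp g) ->
  fun_supp f `<=` `[0, +oo[ -> fun_supp g `<=` `[0, +oo[ ->
  finitely_piecewise_comparable f g ->
  tail_le mu nu \/ tail_le nu mu.
Proof.
move=> df dg acmu acnu cf cg pf pg cmp.
have tmu := density_tail_domain _ _ df cf pf.
have tnu := density_tail_domain _ _ dg cg pg.
pose S := [set c | 0 <= c /\ agree_beyond mu nu c]; pose M := inf S.
have [K1 hK1] := compact_supp_bounded _ cf.
have [K2 hK2] := compact_supp_bounded _ cg.
have S0 : S !=set0.
  exists (Num.max 0 (Num.max K1 K2)); split; first by rewrite le_max lexx.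
  move=> A mA AK.
  have AK' x : A x -> [/\ K1 <= x & K2 <= x].
    by move=> /AK; rewrite /= in_itv/= andbT !ge_max => /and3P[].
  rewrite (density_null _ _ _ df)// ?(density_null _ _ _ dg)// => x /AK'[].
    by move=> _ /hK2.
  by move=> /hK1.
have Slb : lbound S 0 by move=> x [].
have null1 m : m `<< (@lebesgue_measure R) -> m [set M] = 0%E.
  move=> /(_ [set M]); apply=> //.
  move=> B mB BM; apply/eqP; rewrite eq_le measure_ge0 andbT.
  rewrite -[leRHS](lebesgue_measure_set1 M).
  by apply: le_measure; rewrite ?inE//; exact: measurable_set1.
have agreeM : agree_beyond mu nu M.
  by apply: agree_beyond_inf; rewrite ?null1//; [exists 0|move=> c []].
have M_ge0 : 0 <= M by exact: lb_le_inf.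
have [M0|M0] := eqVneq M 0.
  by left; apply: tail_le_of_agree; rewrite -?M0.
have M_gt0 : 0 < M by rewrite lt_neqAle eq_sym M0.
have disagree b : 0 <= b -> b < M -> ~ agree_beyond mu nu b.
  move=> b0 bM agr; have : M <= b by apply: ge_inf => //; exists 0.
  by rewrite leNgt bM.
have [le|le] := comparable_at_left _ _ M cmp.
  by left; exact: (tail_le_of_le_at_left _ _ _ _ M df dg).
right; apply: (tail_le_of_le_at_left _ _ _ _ M dg df) => //.
- by move=> A mA AM; rewrite agreeM.
- by move=> b b0 bM agr; apply: (disagree b b0 bM) => A mA Ab; rewrite agr.
Qed.

End Comparison.

Theorem theorem10 (R : realType) (F : set (R -> R))
    (hF : forall f : R -> R, F f ->
       [/\ piecewise_continuous f, compact (fun_supp f)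
         & fun_supp f `<=` `[0, +oo[])
    (hcmp : forall f1 f2 : R -> R, F f1 -> F f2 ->
       finitely_piecewise_comparable f1 f2) :
  total_on (measures_with_density_in F) (fun mu1 mu2 => tail_le mu1 mu2).
Proof.
move=> mu nu [_ acmu [f Ff df]] [_ acnu [g Fg dg]].
have [_ cf pf] := hF f Ff; have [_ cg pg] := hF g Fg.
exact: (tail_le_total_of_comparable _ _ _ _ _ df dg acmu acnu cf cg pf pg
  (hcmp f g Ff Fg)).
Qed.
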